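(* Let $f:X\to X$ be a continuous map of a compact metric space $(X,d)$. If either $f$ has only countably many distinct stable classes, or $f$ is Lyapunov stable on its recurrent set $R(f)$, then $f$ has zero topological entropy.
   Context: The stable class of $p\in X$ is $W^s(p)=\{x\in X:\lim_{n\to\infty}d(f^n(x),f^n(p))=0\}$. The recurrent set is $R(f)=\{x\in X: x\in\omega_f(x)\}$, where $\omega_f(x)$ is the set of limits $\lim_{k\to\infty}f^{n_k}(x)$ over sequences $n_k\to\infty$. $f$ is Lyapunov stable on $A\subset X$ if for every $x\in A$ and every $\epsilon>0$ there is a neighborhood $U(x)$ of $x$ such that $d(f^n(x),f^n(y))<\epsilon$ for all $n\ge 0$ and all $y\in U(x)\cap A$. *)

(* Defs.v *)
From Stdlib Require Import Reals List Arith.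
From Coquelicot Require Import Coquelicot.
Open Scope R_scope.

Definition is_metric {X : Type} (d : X -> X -> R) : Prop :=
  (forall x y, 0 <= d x y) /\
  (forall x y, d x y = 0 <-> x = y) /\
  (forall x y, d x y = d y x) /\
  (forall x y z, d x z <= d x y + d y z).

Definition metric_open {X : Type} (d : X -> X -> R) (U : X -> Prop) : Prop :=
  forall x, U x -> exists r, 0 < r /\ forall y, d x y < r -> U y.

Definition metric_compact {X : Type} (d : X -> X -> R) : Prop :=
  forall (I : Type) (U : I -> X -> Prop),
    (forall i, metric_open d (U i)) ->
    (forall x, exists i, U i x) ->
    exists l : list I, forall x, exists i, In i l /\ U i x.

Definition metric_continuous {X : Type} (d : X -> X -> R) (f : X -> X) : Prop :=
  forall x eps, 0 < eps ->
    exists delta, 0 < delta /\ forall y, d x y < delta -> d (f x) (f y) < eps.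

Definition stable_class {X : Type} (d : X -> X -> R) (f : X -> X) (p : X)
  (x : X) : Prop :=
  forall eps, 0 < eps -> exists N, forall n, (N <= n)%nat ->
    d (Nat.iter n f x) (Nat.iter n f p) < eps.

Definition countably_many_stable_classes {X : Type} (d : X -> X -> R)
  (f : X -> X) : Prop :=
  exists c : nat -> (X -> Prop),
    forall p, exists k, forall x, stable_class d f p x <-> c k x.

Definition omega_limit {X : Type} (d : X -> X -> R) (f : X -> X) (x y : X)
  : Prop :=
  exists nk : nat -> nat,
    (forall M, exists K, forall k, (K <= k)%nat -> (M <= nk k)%nat) /\
    (forall eps, 0 < eps -> exists K, forall k, (K <= k)%nat ->
       d (Nat.iter (nk k) f x) y < eps).

Definition recurrent_set {X : Type} (d : X -> X -> R) (f : X -> X)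
  (x : X) : Prop := omega_limit d f x x.

Definition lyapunov_stable_on {X : Type} (d : X -> X -> R) (f : X -> X)
  (A : X -> Prop) : Prop :=
  forall x, A x -> forall eps, 0 < eps ->
    exists r, 0 < r /\
      forall y, d x y < r -> A y ->
        forall n, d (Nat.iter n f x) (Nat.iter n f y) < eps.

Definition separated_set {X : Type} (d : X -> X -> R) (f : X -> X)
  (n : nat) (eps : R) (E : list X) : Prop :=
  NoDup E /\
  forall x y, In x E -> In y E -> x <> y ->
    exists k, (k < n)%nat /\ eps < d (Nat.iter k f x) (Nat.iter k f y).

(** sup over n >= N (n >= 1) of (1/n) log s(n,eps), where s(n,eps) is the
    maximal cardinality of an (n,eps)-separated set
    (log of max(1,card), so the empty set contributes 0). *)
Definition tail_sup {X : Type} (d : X -> X -> R) (f : X -> X) (eps : R)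
  (N : nat) : Rbar :=
  Lub_Rbar (fun r => exists n (E : list X), (N <= n)%nat /\ (0 < n)%nat /\
    separated_set d f n eps E /\ r = ln (INR (Nat.max 1 (length E))) / INR n).

Definition entropy_eps {X : Type} (d : X -> X -> R) (f : X -> X) (eps : R)
  : Rbar := Rbar_glb (fun y => exists N, y = tail_sup d f eps N).

(** h_top(f) = sup_{eps>0} h_eps (= lim_{eps->0} since monotone). *)
Definition topological_entropy {X : Type} (d : X -> X -> R) (f : X -> X)
  : Rbar := Rbar_lub (fun y => exists eps, 0 < eps /\ y = entropy_eps d f eps).

(* Main.v *)
Require Import Defs.
From Stdlib Require Import Reals List Arith Lia Lra Classical ClassicalEpsilon Cantor.
From Coquelicot Require Import Coquelicot.
Import ListNotations.

(** Suppose the entropy is positive.  A Sauer-Shelah type count on exponentially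
    large [(n, eps)]-separated sets yields two closed sets [A], [B] at positive
    distance which are independent along sets of times of positive density: every
    pattern of visits to [A] or [B] along these times is realized.  Positive-density
    independence of [(C, B)] survives when [C] is cut into finitely many pieces
    (for one of the pieces), and when [C] is replaced by either of
    [C /\ f^-m C] and [C /\ f^-m B], for suitable arbitrarily large [m].  A set whose
    points have orbits eventually closer to each other than the distance from [A]
    to [B] cannot meet both of these, so countably many such sets can be avoided
    one after the other, while the returns to small pieces force the limit point
    to be recurrent.  Each of the two hypotheses of the theorem covers the
    recurrent set by countably many sets of this kind, at every scale. *)

(** * Selecting from lists, and words with marked letters *)

Definition asb (P : Prop) : bool :=
  if excluded_middle_informative P then true else false.

Lemma asb_true (P : Prop) : asb P = true <-> P.
Proof. unfold asb; destruct (excluded_middle_informative P); intuition congruence. Qed.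

Lemma asb_false (P : Prop) : asb P = false <-> ~ P.
Proof. unfold asb; destruct (excluded_middle_informative P); intuition congruence. Qed.

Definition sel {A : Type} (P : A -> Prop) (l : list A) : list A :=
  filter (fun a => asb (P a)) l.

Lemma in_sel {A : Type} (P : A -> Prop) (l : list A) (a : A) :
  In a (sel P l) <-> In a l /\ P a.
Proof. unfold sel; rewrite filter_In, asb_true; tauto. Qed.

Lemma sel_length_split {A : Type} (P : A -> Prop) (l : list A) :
  (length (sel P l) + length (sel (fun a => ~ P a) l))%nat = length l.
Proof.
  unfold sel, asb; induction l as [|a l IH]; simpl; auto.
  destruct (excluded_middle_informative (P a));
    destruct (excluded_middle_informative (~ P a)); simpl; try lia; tauto.
Qed.

Lemma sel_length_le {A : Type} (P Q : A -> Prop) (l : list A) :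
  (forall a, In a l -> P a -> Q a) ->
  (length (sel P l) <= length (sel Q l))%nat.
Proof.
  unfold sel; induction l as [|a l IH]; simpl; intros H; auto.
  assert (length (filter (fun b => asb (P b)) l)
          <= length (filter (fun b => asb (Q b)) l))%nat by (apply IH; auto).
  destruct (asb (P a)) eqn:E; destruct (asb (Q a)) eqn:F; simpl; try lia.
  rewrite asb_true in E; rewrite asb_false in F; exfalso; auto.
Qed.

Lemma sel_none {A : Type} (P : A -> Prop) (l : list A) :
  (forall a, In a l -> ~ P a) -> sel P l = [].
Proof.
  intros H; destruct (sel P l) as [|a m] eqn:E; auto.
  assert (In a (sel P l)) as K by (rewrite E; simpl; auto).
  apply in_sel in K; exfalso; apply (H a); tauto.
Qed.

Lemma sel_NoDup {A : Type} (P : A -> Prop) (l : list A) : NoDup l -> NoDup (sel P l).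
Proof. apply NoDup_filter. Qed.

(** Besides discarding small parts, this serves as a pigeonhole principle: when the selections
    exhaust the list, some index carries at least the average share. *)
Lemma sel_union_bound {A I : Type} (q : I -> A -> Prop) (l : list A) (c : R)
  (L : list I) :
  (forall i, In i L -> INR (length (sel (q i) l)) <= c) ->
  INR (length (sel (fun a => exists i, In i L /\ q i a) l)) <= INR (length L) * c.
Proof.
  induction L as [|i L IH]; intros H.
  - rewrite sel_none by (intros a _ [i [[] _]]); simpl; lra.
  - set (Q := fun a => exists j, In j L /\ q j a).
    assert (INR (length (sel Q l)) <= INR (length L) * c) as B
      by (apply IH; intros; apply H; simpl; auto).
    assert (INR (length (sel (q i) l)) <= c) as C by (apply H; simpl; auto).
    assert (length (sel (fun a => exists j, In j (i :: L) /\ q j a) l)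
            <= length (sel (q i) l) + length (sel Q l))%nat as D.
    { clear. unfold sel; induction l as [|a l IH]; simpl; auto.
      destruct (asb (exists j, (i = j \/ In j L) /\ q j a)) eqn:E;
        destruct (asb (q i a)) eqn:F; destruct (asb (Q a)) eqn:G; simpl in *; try lia.
      exfalso. rewrite asb_true in E; rewrite asb_false in F; rewrite asb_false in G.
      destruct E as [j [[->|E] E']]; [auto | apply G; exists j; auto]. }
    apply le_INR in D; rewrite plus_INR in D.
    change (length (i :: L)) with (S (length L)); rewrite S_INR; lra.
Qed.

(** * Weighted sums over lists *)

Definition lsum {A : Type} (g : A -> R) (l : list A) : R :=
  fold_right (fun a s => g a + s) 0 l.

Lemma lsum_app {A : Type} (g : A -> R) (l l' : list A) :
  lsum g (l ++ l') = lsum g l + lsum g l'.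
Proof. induction l; simpl; [|rewrite IHl]; lra. Qed.

(** Only the smaller list has to be free of repetitions: the larger one will be [words n], which may
    repeat entries when [ps] does. *)
Lemma lsum_incl {A : Type} (g : A -> R) (l l' : list A) :
  (forall a, 0 <= g a) -> NoDup l -> incl l l' -> lsum g l <= lsum g l'.
Proof.
  intros Hg; revert l'; induction l as [|a l IH]; intros l' Hn Hi; simpl.
  - clear Hi; induction l'; simpl; [lra | specialize (Hg a); lra].
  - inversion Hn; subst.
    destruct (in_split a l') as [l1 [l2 ->]]; [apply Hi; simpl; auto|].
    specialize (IH (l1 ++ l2)); rewrite lsum_app in *; simpl in *.
    assert (incl l (l1 ++ l2)).
    { intros b Hb. assert (In b (l1 ++ a :: l2)) as K by (apply Hi; simpl; auto).
      apply in_app_or in K; simpl in K; apply in_or_app.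
      destruct K as [K|[->|K]]; tauto. }
    specialize (IH H2 H); lra.
Qed.

Lemma lsum_ge {A : Type} (g : A -> R) (c : R) (l : list A) :
  (forall a, In a l -> c <= g a) -> INR (length l) * c <= lsum g l.
Proof.
  induction l as [|a l IH]; intros H; [simpl; lra|].
  simpl length; rewrite S_INR; simpl lsum.
  assert (c <= g a) by (apply H; simpl; auto).
  assert (INR (length l) * c <= lsum g l) by (apply IH; intros; apply H; simpl; auto).
  lra.
Qed.

Section Words.
Context {P : Type} (ps : list P).

(** Positions stand for times: [Some p] will mark a time shattered by the pair [p], and [None] a
    time at which nothing is claimed. *)
Fixpoint words (n : nat) : list (list (option P)) :=
  match n with
  | O => [[]]
  | S n => flat_map (fun w => (None :: w) :: map (fun p => Some p :: w) ps) (words n)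
  end.

Fixpoint marked (w : list (option P)) : nat :=
  match w with
  | [] => O
  | None :: w => marked w
  | Some _ :: w => S (marked w)
  end.

Lemma words_None (n : nat) (w : list (option P)) :
  In w (words n) -> In (None :: w) (words (S n)).
Proof. intros H; simpl; apply in_flat_map; exists w; simpl; auto. Qed.

Lemma words_Some (n : nat) (w : list (option P)) (p : P) :
  In p ps -> In w (words n) -> In (Some p :: w) (words (S n)).
Proof.
  intros Hp H; simpl; apply in_flat_map; exists w; split; auto.
  right; apply in_map_iff; eauto.
Qed.

Lemma words_letter (n : nat) (w : list (option P)) (p : P) :
  In w (words n) -> In (Some p) w -> In p ps.
Proof.
  revert w; induction n as [|n IH]; simpl; intros w H K.
  - destruct H as [<-|[]]; destruct K.
  - apply in_flat_map in H; destruct H as [v [Hv [<-|H]]]; simpl in K.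
    + destruct K as [K|K]; [discriminate | eauto].
    + apply in_map_iff in H; destruct H as [q [<- Hq]].
      destruct K as [K|K]; [injection K as ->; auto | eauto].
Qed.

Lemma words_length (n : nat) (w : list (option P)) : In w (words n) -> length w = n.
Proof.
  revert w; induction n as [|n IH]; simpl; intros w H.
  - destruct H as [<-|[]]; auto.
  - apply in_flat_map in H; destruct H as [v [Hv [<-|H]]]; simpl; [f_equal; auto|].
    apply in_map_iff in H; destruct H as [q [<- Hq]]; simpl; f_equal; auto.
Qed.

(** The weight is multiplicative over positions; each position contributes 1 for [None] and [t] for
    every letter of [ps]. *)
Lemma words_weight (t : R) (n : nat) :
  lsum (fun w => t ^ marked w) (words n) = (1 + INR (length ps) * t) ^ n.
Proof.
  induction n as [|n IH]; [simpl; lra|].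
  simpl words; simpl pow; rewrite <- IH; clear IH.
  induction (words n) as [|w l IH]; [simpl; lra|].
  simpl flat_map; change (?a :: ?b ++ ?c) with ((a :: b) ++ c).
  rewrite lsum_app, IH; simpl.
  assert (lsum (fun v => t ^ marked v) (map (fun p => Some p :: w) ps)
          = INR (length ps) * t * t ^ marked w) as ->; [|lra].
  clear. induction ps as [|p q IH]; [simpl; lra|].
  simpl length; rewrite S_INR; simpl; rewrite IH; lra.
Qed.

(* Exponential Markov inequality for the weight [exp (- theta * marked w)]. *)
Lemma many_words_heavily_marked (g : R) :
  0 < g -> exists eta, 0 < eta /\
  forall n W, (1 <= n)%nat -> NoDup W -> incl W (words n) ->
    exp (g * INR n) <= INR (length W) ->
    exists w, In w W /\ eta * INR n <= INR (marked w).
Proof.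
  intros Hg.
  set (K := INR (length ps)).
  assert (0 <= K) by apply pos_INR.
  (* Large enough that [K * t <= g / 3], which bounds the total weight of all words by
     [exp (g / 3 * INR n)]. *)
  set (th := 1 + Rmax 0 (ln (3 * (K + 1) / g))).
  assert (0 < 3 * (K + 1) / g) by (apply Rdiv_lt_0_compat; lra).
  assert (1 <= th) by (unfold th; generalize (Rmax_l 0 (ln (3 * (K + 1) / g))); lra).
  set (t := exp (- th)).
  assert (0 < t) by apply exp_pos.
  assert (K * t <= g / 3) as Kt.
  { assert (t <= exp (- ln (3 * (K + 1) / g))) as T.
    { apply Rlt_le, exp_increasing; unfold th.
      generalize (Rmax_r 0 (ln (3 * (K + 1) / g))); lra. }
    rewrite exp_Ropp, exp_ln in T by auto.
    apply Rle_trans with ((K + 1) * / (3 * (K + 1) / g)).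
    - apply Rle_trans with ((K + 1) * t); [|apply Rmult_le_compat_l]; nra.
    - right; field; lra. }
  (* A word with fewer than [eta * INR n] marks weighs more than [exp (- (g / 3 * INR n))]. If all
     words of [W] were like that, their total weight would be at least [exp (2 * g / 3 * INR n)],
     which is too much. *)
  exists (g / (3 * th)); split; [apply Rdiv_lt_0_compat; lra|].
  intros n W Hn HW HI HL.
  apply NNPP; intros no.
  assert (0 < INR n) by (apply lt_0_INR; lia).
  assert (INR (length W) * exp (- (g / 3 * INR n)) <= lsum (fun w => t ^ marked w) W) as A.
  { apply lsum_ge; intros w Hw.
    assert (INR (marked w) < g / (3 * th) * INR n) as Hm.
    { apply Rnot_le_lt; intros ?; apply no; exists w; auto. }
    rewrite <- Rpower_pow by auto; unfold Rpower, t; rewrite ln_exp.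
    apply Rlt_le, exp_increasing.
    apply Rmult_lt_compat_r with (r := th) in Hm; [|lra].
    replace (g / (3 * th) * INR n * th) with (g / 3 * INR n) in Hm by (field; lra).
    lra. }
  assert (lsum (fun w => t ^ marked w) W <= exp (g / 3 * INR n)) as B.
  { eapply Rle_trans; [apply lsum_incl with (l' := words n); auto|].
    - intros; apply pow_le; lra.
    - rewrite words_weight; fold K.
      assert (0 <= K * t) by (apply Rmult_le_pos; lra).
      apply Rle_trans with (exp (g / 3) ^ n).
      + apply pow_incr; split; [lra|].
        eapply Rle_trans; [|apply exp_ineq1_le]; lra.
      + rewrite <- Rpower_pow by apply exp_pos; unfold Rpower; rewrite ln_exp.
        right; f_equal; lra. }
  assert (exp (g * INR n) * exp (- (g / 3 * INR n)) <= exp (g / 3 * INR n)) as C.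
  { eapply Rle_trans; [|apply B]; eapply Rle_trans; [|apply A].
    apply Rmult_le_compat_r; auto; apply Rlt_le, exp_pos. }
  rewrite <- exp_plus in C.
  apply Rle_not_lt in C; apply C, exp_increasing; nra.
Qed.

End Words.

(** * Shattering *)

Section Shattering.
Context {X : Type} (f : X -> X).

Definition shatters (J : list nat) (A B : X -> Prop) : Prop :=
  forall s : nat -> bool, exists x, forall j, In j J ->
    if s j then A (Nat.iter j f x) else B (Nat.iter j f x).

(** Each marked time has its own pair of sets, and [S] accumulates the constraints chosen so far.
    The same tail of the word is demanded on both branches, so a word common to both parts of [S]
    can be prolonged by a mark. *)
Fixpoint shatters_word (S : X -> Prop) (zs : list nat)
  (w : list (option ((X -> Prop) * (X -> Prop)))) : Prop :=
  match zs, w with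
  | [], [] => exists x, S x
  | z :: zs, None :: w => shatters_word S zs w
  | z :: zs, Some (U, V) :: w =>
      shatters_word (fun x => S x /\ U (Nat.iter z f x)) zs w /\
      shatters_word (fun x => S x /\ V (Nat.iter z f x)) zs w
  | _, _ => False
  end.

Lemma shatters_word_mono (zs : list nat) w (S T : X -> Prop) :
  (forall x, S x -> T x) -> shatters_word S zs w -> shatters_word T zs w.
Proof.
  revert w S T; induction zs as [|z zs IH]; intros [|[[U V]|] w] S T H; simpl; auto.
  - intros [x Hx]; eauto.
  - intros [HU HV]; split; [revert HU | revert HV]; apply IH; intros x [? ?]; auto.
  - apply IH; auto.
Qed.

Lemma shatters_word_realized (zs : list nat) w (S : X -> Prop) (s : nat -> bool) :
  shatters_word S zs w ->
  exists x, S x /\ forall z U V, In (z, Some (U, V)) (combine zs w) ->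
    if s z then U (Nat.iter z f x) else V (Nat.iter z f x).
Proof.
  revert w S; induction zs as [|z zs IH]; intros [|[[U V]|] w] S H;
    simpl in H; try tauto.
  - destruct H as [x Hx]; exists x; split; auto; intros ? ? ? [].
  - destruct H as [HU HV].
    destruct (s z) eqn:E; [destruct (IH _ _ HU) as [x [[Sx Ux] Hx]]
                          | destruct (IH _ _ HV) as [x [[Sx Ux] Hx]]];
      exists x; split; auto; intros z' U' V' [K|K]; try exact (Hx _ _ _ K);
      injection K as <- <- <-; rewrite E; auto.
  - destruct (IH _ _ H) as [x [Sx Hx]]; exists x; split; auto.
    intros z' U' V' [K|K]; [discriminate | exact (Hx _ _ _ K)].
Qed.

Context (L : list (X -> Prop)) (far : (X -> Prop) -> (X -> Prop) -> Prop).

Definition far_pairs := sel (fun p => far (fst p) (snd p)) (list_prod L L).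

(* Either two far letters are heavy at time [z], and then the patterns shattered
   by the two corresponding parts of [S] add up (Pajor); or no two heavy letters
   are far, and discarding the points carrying a light letter costs only a
   factor [exp (- kappa)]. *)
Lemma count_shattered_words (delta alpha kappa : R) :
  0 < delta -> 0 < alpha -> 0 <= kappa ->
  exp (- kappa) <= 1 - INR (length L) * delta ->
  1 <= 2 * exp (alpha * ln delta) ->
  (forall U, In U L -> ~ far U U) ->
  forall zs S, NoDup S -> S <> [] ->
  (forall x z, In x S -> In z zs -> exists U, In U L /\ U (Nat.iter z f x)) ->
  (forall x y, In x S -> In y S -> x <> y -> exists z, In z zs /\
     forall U V, In U L -> In V L ->
       U (Nat.iter z f x) -> V (Nat.iter z f y) -> far U V) ->
  exists W, NoDup W /\ incl W (words far_pairs (length zs)) /\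
    (forall w, In w W -> shatters_word (fun x => In x S) zs w) /\
    exp (alpha * (ln (INR (length S)) - kappa * INR (length zs)))
      <= INR (length W).
Proof.
  intros Hd Ha Hk Hkd Had Hirr.
  induction zs as [|z zs IH]; intros S HS Hne Hcov Hsep.
  - exists [[]]; repeat split.
    + repeat constructor; simpl; tauto.
    + intros w Hw; exact Hw.
    + intros w [<-|[]]; simpl. destruct S as [|x S]; [congruence|]; exists x; simpl; auto.
    (* With no time left to separate points, [S] is a single point, and the bound reduces to 1, the
       count of the empty word. *)
    + destruct S as [|x [|y S]]; [congruence| |].
      * simpl; rewrite ln_1; replace (alpha * (0 - kappa * 0)) with 0 by ring.
        rewrite exp_0; lra.
      * destruct (Hsep x y) as [z [[] _]]; simpl; auto.
        intros ->; inversion HS; subst; simpl in *; tauto.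
  - assert (0 < INR (length S)) as Spos.
    { apply lt_0_INR; destruct S; [congruence | simpl; lia]. }
    set (part := fun U : X -> Prop => sel (fun x => U (Nat.iter z f x)) S).
    set (heavy := fun U => delta * INR (length S) <= INR (length (part U))).
    destruct (classic (exists U V, In U L /\ In V L /\ heavy U /\ heavy V /\ far U V))
      as [[U [V [HU [HV [hU [hV HUV]]]]]]|no].
    (* Restricting to a heavy part multiplies the cardinality by at least [delta], hence the bound
       by at least [exp (alpha * ln delta) >= / 2]. Two points of the part are never separated at
       time [z], because [far T T] fails. *)
    + assert (forall T, In T L -> heavy T -> exists W, NoDup W /\
        incl W (words far_pairs (length zs)) /\
        (forall w, In w W -> shatters_word
           (fun x => In x S /\ T (Nat.iter z f x)) zs w) /\
        / 2 * exp (alpha * (ln (INR (length S)) - kappa * INR (Datatypes.S (length zs))))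
          <= INR (length W)) as branch.
      { intros T HT hT; unfold heavy in hT.
        assert (0 < delta * INR (length S)) by nra.
        destruct (IH (part T)) as [W [W1 [W2 [W3 W4]]]].
        - apply sel_NoDup; auto.
        - intros E; rewrite E in hT; simpl in hT; lra.
        - intros x z' Hx Hz; apply in_sel in Hx; apply Hcov; simpl; tauto.
        - intros x y Hx Hy Hxy; apply in_sel in Hx; apply in_sel in Hy.
          destruct (Hsep x y) as [z' [[<-|Hz'] H']]; try tauto.
          + exfalso; apply (Hirr T HT), H'; tauto.
          + exists z'; split; auto.
        - exists W; repeat split; auto.
          + intros w Hw; eapply shatters_word_mono; [|apply W3, Hw].
            intros x Hx; apply in_sel in Hx; exact Hx.
          + eapply Rle_trans; [|exact W4].
            apply Rle_trans with (exp (alpha * ln delta) *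
              exp (alpha * (ln (INR (length S)) - kappa * INR (Datatypes.S (length zs))))).
            * apply Rmult_le_compat_r; [apply Rlt_le, exp_pos | lra].
            * rewrite <- exp_plus.
              assert (ln delta + ln (INR (length S)) <= ln (INR (length (part T)))).
              { rewrite <- ln_mult by auto; apply ln_le; auto. }
              rewrite S_INR.
              match goal with |- exp ?a <= exp ?b =>
                destruct (Rle_lt_or_eq_dec a b) as [l|e] end;
                [nra | apply Rlt_le, exp_increasing, l | rewrite e; lra]. }
      destruct (branch U HU hU) as [WU [U1 [U2 [U3 U4]]]].
      destruct (branch V HV hV) as [WV [V1 [V2 [V3 V4]]]].
      (* Words of the union of [WU] and [WV] are prolonged by [None], those of the intersection also
         by [Some (U, V)]. The total is the sum of the two cardinalities, so the two halves add up
         to the full bound. *)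
      set (new := sel (fun w => ~ In w WU) WV).
      set (both := sel (fun w => In w WU) WV).
      assert (In (U, V) far_pairs) as Hp.
      { apply in_sel; split; [apply in_prod; auto | auto]. }
      exists (map (cons None) (WU ++ new) ++ map (cons (Some (U, V))) both).
      assert (forall o : option ((X -> Prop) * (X -> Prop)), forall l,
        NoDup l -> NoDup (map (cons o) l)) as ND.
      { intros o l Hl; apply NoDup_map_NoDup_ForallPairs; auto.
        intros a b _ _ E; injection E; auto. }
      repeat split.
      * apply NoDup_app.
        -- apply ND, NoDup_app; auto; [apply sel_NoDup; auto|].
           intros w Hw Hn; apply in_sel in Hn; tauto.
        -- apply ND, sel_NoDup; auto.
        -- intros w Hw Hw'; apply in_map_iff in Hw; apply in_map_iff in Hw'.
           destruct Hw as [? [<- _]]; destruct Hw' as [? [E _]]; discriminate.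
      * intros w Hw; apply in_app_or in Hw; rewrite !in_map_iff in Hw.
        destruct Hw as [[v [<- Hv]]|[v [<- Hv]]].
        -- apply words_None; apply in_app_or in Hv; destruct Hv as [Hv|Hv]; auto.
           apply in_sel in Hv; apply V2; tauto.
        -- apply words_Some; auto. apply in_sel in Hv; apply V2; tauto.
      * intros w Hw; apply in_app_or in Hw; rewrite !in_map_iff in Hw.
        destruct Hw as [[v [<- Hv]]|[v [<- Hv]]]; simpl.
        -- apply in_app_or in Hv; destruct Hv as [Hv|Hv].
           ++ eapply shatters_word_mono; [|apply U3, Hv]; simpl; tauto.
           ++ apply in_sel in Hv.
              eapply shatters_word_mono; [|apply V3, Hv]; simpl; tauto.
        -- apply in_sel in Hv; split; [apply U3 | apply V3]; tauto.
      * rewrite length_app, !length_map, length_app.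
        rewrite <- Nat.add_assoc, (Nat.add_comm (length new)).
        unfold new, both; rewrite sel_length_split, plus_INR.
        simpl length; lra.
    (* There are at most [length L] light letters and each carries less than a fraction [delta] of
       [S], so a fraction [exp (- kappa)] remains. *)
    + set (S' := sel (fun x => ~ exists U, In U L /\ ~ heavy U /\ U (Nat.iter z f x)) S).
      assert (exp (- kappa) * INR (length S) <= INR (length S')) as big.
      { set (D := fun x => exists U, In U L /\ ~ heavy U /\ U (Nat.iter z f x)).
        assert (INR (length (sel D S)) <= INR (length L) * (delta * INR (length S))) as E.
        { apply (sel_union_bound (fun U x => ~ heavy U /\ U (Nat.iter z f x))).
          intros U HU; destruct (classic (heavy U)) as [h|h].
          - apply Rle_trans with 0; [|nra].
            rewrite sel_none by tauto; simpl; lra.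
          - apply Rle_trans with (INR (length (part U))).
            + apply le_INR, sel_length_le; tauto.
            + unfold heavy in h; lra. }
        assert (INR (length S) = INR (length (sel D S)) + INR (length S')) as F.
        { rewrite <- plus_INR; f_equal; symmetry; apply sel_length_split. }
        nra. }
      assert (0 < exp (- kappa) * INR (length S)).
      { apply Rmult_lt_0_compat; auto; apply exp_pos. }
      destruct (IH S') as [W [W1 [W2 [W3 W4]]]].
      * apply sel_NoDup; auto.
      * intros E; rewrite E in big; simpl in big; lra.
      * intros x z' Hx Hz; apply in_sel in Hx; apply Hcov; simpl; tauto.
      * intros x y Hx Hy Hxy; apply in_sel in Hx; apply in_sel in Hy.
        destruct Hx as [Hx nx]; destruct Hy as [Hy ny].
        destruct (Hsep x y) as [z' [[<-|Hz'] H']]; try tauto; [|exists z'; auto].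
        (* Two points of [S'] carry only heavy letters at time [z]; being separated there would make
           two of these letters far. *)
        exfalso; apply no.
        destruct (Hcov x z) as [U [HU Ux]]; simpl; auto.
        destruct (Hcov y z) as [V [HV Vy]]; simpl; auto.
        exists U, V; repeat split; auto; apply NNPP; intros nh.
        -- apply nx; exists U; auto.
        -- apply ny; exists V; auto.
      * exists (map (cons None) W); repeat split.
        -- apply NoDup_map_NoDup_ForallPairs; auto.
           intros a b _ _ E; injection E; auto.
        -- intros w Hw; apply in_map_iff in Hw; destruct Hw as [v [<- Hv]].
           apply words_None; auto.
        -- intros w Hw; apply in_map_iff in Hw; destruct Hw as [v [<- Hv]]; simpl.
           eapply shatters_word_mono; [|apply W3, Hv].
           intros x Hx; apply in_sel in Hx; tauto.
        -- rewrite length_map; eapply Rle_trans; [|exact W4].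
           assert (- kappa + ln (INR (length S)) <= ln (INR (length S'))).
           { rewrite <- (ln_exp (- kappa)), <- ln_mult by (auto; apply exp_pos).
             apply ln_le; auto. }
           change (length (z :: zs)) with (Datatypes.S (length zs)); rewrite S_INR.
           match goal with |- exp ?a <= exp ?b =>
             destruct (Rle_lt_or_eq_dec a b) as [l|e] end;
             [nra | apply Rlt_le, exp_increasing, l | rewrite e; lra].
Qed.

(** Exponentially many shattered words force one of them to have a positive proportion of marks. Its
    most frequent letter is then a single far pair, shattering the set of times at which it
    occurs. *)
Lemma large_shattered_subset (c : R) :
  0 < c -> (forall U, In U L -> ~ far U U) ->
  exists eta, 0 < eta /\
  forall zs S, NoDup zs -> zs <> [] -> NoDup S ->
    exp (c * INR (length zs)) <= INR (length S) ->
    (forall x z, In x S -> In z zs -> exists U, In U L /\ U (Nat.iter z f x)) ->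
    (forall x y, In x S -> In y S -> x <> y -> exists z, In z zs /\
       forall U V, In U L -> In V L ->
         U (Nat.iter z f x) -> V (Nat.iter z f y) -> far U V) ->
    exists U V J, In U L /\ In V L /\ far U V /\ NoDup J /\ incl J zs /\
      eta * INR (length zs) <= INR (length J) /\ shatters J U V.
Proof.
  intros Hc Hirr.
  set (K := INR (length L)).
  assert (0 <= K) by apply pos_INR.
  (* Half of the growth rate [c] pays for the discarded points; the other half survives, so the
     words grow at rate [alpha * kappa]. *)
  set (kappa := c / 2).
  assert (0 < exp (- kappa) < 1) as Hk.
  { split; [apply exp_pos|]. rewrite <- exp_0; apply exp_increasing; unfold kappa; lra. }
  set (delta := (1 - exp (- kappa)) / (K + 1)).
  assert (0 < delta) as Hd by (apply Rdiv_lt_0_compat; lra).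
  assert (delta * (K + 1) = 1 - exp (- kappa)) as Hd1 by (unfold delta; field; lra).
  assert (delta < 1) by nra.
  assert (ln delta < 0) by (rewrite <- ln_1; apply ln_increasing; auto).
  assert (0 < ln 2) by (rewrite <- ln_1; apply ln_increasing; lra).
  (* This makes [exp (alpha * ln delta)] exactly one half. *)
  set (alpha := ln 2 / - ln delta).
  assert (0 < alpha) as Hal by (apply Rdiv_lt_0_compat; lra).
  destruct (many_words_heavily_marked far_pairs (alpha * kappa)) as [eta [He Hmark]];
    [unfold kappa; nra|].
  set (M := INR (length far_pairs)).
  assert (0 <= M) by apply pos_INR.
  (* If each of the [M] far pairs occurred less often than this, there would be strictly fewer than
     [eta * INR (length zs)] marks; [M + 1] keeps the estimate strict and allows [M = 0]. *)
  exists (eta / (M + 1)); split; [apply Rdiv_lt_0_compat; lra|].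
  intros zs S Hz Hzne HS HL Hcov Hsep.
  assert (1 <= length zs)%nat by (destruct zs; [congruence | simpl; lia]).
  assert (0 < exp (c * INR (length zs))) by apply exp_pos.
  destruct (count_shattered_words delta alpha kappa) with zs S
    as [W [W1 [W2 [W3 W4]]]]; auto; try (unfold kappa; lra).
  - fold K; nra.
  - replace (alpha * ln delta) with (- ln 2) by (unfold alpha; field; lra).
    rewrite exp_Ropp, exp_ln by lra; lra.
  - intros ->; simpl in HL; lra.
  - destruct (Hmark (length zs) W) as [w [Hw Hm]]; auto.
    { eapply Rle_trans; [|exact W4].
      assert (c * INR (length zs) <= ln (INR (length S))).
      { rewrite <- (ln_exp (c * INR (length zs))); apply ln_le; auto. }
      match goal with |- exp ?a <= exp ?b =>
        destruct (Rle_lt_or_eq_dec a b) as [l|e] end;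
        [ | apply Rlt_le, exp_increasing, l | rewrite e; lra].
      rewrite Rmult_assoc; apply Rmult_le_compat_l; [lra|]; unfold kappa; lra. }
    assert (exists p, In p far_pairs /\ eta / (M + 1) * INR (length zs) <=
      INR (length (sel (fun e => snd e = Some p) (combine zs w)))) as [[U V] [Hp HJ]].
    { apply NNPP; intros no.
      assert (length w = length zs) as Hlen by (eapply words_length; eauto).
      assert (0 < INR (length zs)) by (apply lt_0_INR; lia).
      assert (INR (length (sel (fun e : nat * _ => exists p, In p far_pairs
         /\ snd e = Some p) (combine zs w)))
         <= M * (eta / (M + 1) * INR (length zs))) as B.
      { apply (sel_union_bound (fun p e => snd e = Some p)); intros p Hp.
        apply Rlt_le, Rnot_le_lt; intros ?; apply no; exists p; auto. }
      assert (marked w <= length (sel (fun e : nat * _ => exists p, In p far_pairs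
         /\ snd e = Some p) (combine zs w)))%nat as C.
      { assert (forall p, In (Some p) w -> In p far_pairs) as Hl
          by (intros p; eapply words_letter; eauto).
        clear - Hlen Hl. revert zs Hlen Hl; induction w as [|o w IH];
          intros [|z zs] Hlen Hl; simpl in *; try discriminate; [lia|].
        assert (marked w <= length (sel (fun e : nat * _ => exists p, In p far_pairs
         /\ snd e = Some p) (combine zs w)))%nat by (apply IH; auto).
        unfold sel in *; destruct o as [p|]; simpl.
        - replace (asb _) with true; [simpl; lia|].
          symmetry; apply asb_true; exists p; auto.
        - destruct (asb _); simpl; lia. }
      apply le_INR in C.
      assert (M * (eta / (M + 1) * INR (length zs)) < eta * INR (length zs)); [|lra].
      replace (M * (eta / (M + 1) * INR (length zs)))
        with (eta * INR (length zs) * (M / (M + 1))) by (field; lra).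
      assert (M / (M + 1) < 1) by (apply Rlt_div_l; lra).
      assert (0 < eta * INR (length zs)) by nra; nra. }
    apply in_sel in Hp; destruct Hp as [HUV Hfar]; apply in_prod_iff in HUV.
    exists U, V, (map fst (sel (fun e => snd e = Some (U, V)) (combine zs w))).
    repeat split; try tauto.
    + clear - Hz; unfold sel; revert w; induction Hz as [|z zs Hn Hz IH]; intros [|o w];
        simpl; try constructor.
      destruct (asb _); simpl; auto; constructor; auto.
      intros Q; apply Hn; apply in_map_iff in Q; destruct Q as [[a b] [<- Q]].
      apply filter_In in Q; simpl; eapply in_combine_l; apply Q.
    + intros j Hj; apply in_map_iff in Hj; destruct Hj as [[a b] [<- Q]].
      apply in_sel in Q; simpl; eapply in_combine_l; apply Q.
    + rewrite length_map; auto.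
    + intros s; destruct (shatters_word_realized zs w _ s (W3 w Hw)) as [x [_ Hx]].
      exists x; intros j Hj; apply in_map_iff in Hj; destruct Hj as [[a b] [<- Q]].
      apply in_sel in Q; simpl in *; destruct Q as [Q ->]; exact (Hx _ _ _ Q).
Qed.

End Shattering.

(** * Independence of positive density *)

Lemma frequent_choice {T : Type} (l : list T) (Q : nat -> T -> Prop) :
  (forall N, exists n t, (N <= n)%nat /\ In t l /\ Q n t) ->
  exists t, In t l /\ forall N, exists n, (N <= n)%nat /\ Q n t.
Proof.
  induction l as [|a l IH]; intros H.
  - destruct (H O) as [n [t [_ [[] _]]]].
  - destruct (classic (forall N, exists n, (N <= n)%nat /\ Q n a)) as [y|no].
    + exists a; simpl; auto.
    + apply not_all_ex_not in no; destruct no as [N0 no].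
      destruct IH as [t [Ht HQ]]; [|exists t; simpl; auto].
      intros N; destruct (H (max N N0)) as [n [t [Hn [[<-|Ht] HQ]]]].
      * exfalso; apply no; exists n; split; auto; lia.
      * exists n, t; repeat split; auto; lia.
Qed.

Lemma NoDup_map_injective {A B : Type} (g : A -> B) (l : list A) (a b : A) :
  NoDup (map g l) -> In a l -> In b l -> g a = g b -> a = b.
Proof.
  induction l as [|c l IH]; simpl; [tauto|].
  intros H Ha Hb E; inversion H as [|? ? Hn Hl]; subst.
  destruct Ha as [->|Ha]; destruct Hb as [->|Hb]; auto; exfalso; apply Hn.
  - rewrite E; apply in_map; auto.
  - rewrite <- E; apply in_map; auto.
Qed.

Lemma exists_min (l : list nat) :
  l <> [] -> exists j, In j l /\ forall k, In k l -> (j <= k)%nat.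
Proof.
  induction l as [|a [|b l] IH]; intros H; [congruence| |].
  - exists a; split; simpl; auto; intros k [<-|[]]; auto.
  - destruct IH as [j [Hj Hk]]; [congruence|].
    destruct (le_lt_dec a j).
    + exists a; split; [simpl; auto|]; intros k [<-|K]; auto.
      specialize (Hk k K); lia.
    + exists j; split; [simpl in *; tauto|]; intros k [<-|K]; auto; lia.
Qed.

Lemma exists_spread_pair (M : nat) (l : list nat) :
  NoDup l -> (M < length l)%nat ->
  exists j k, In j l /\ In k l /\ (j + M <= k)%nat.
Proof.
  intros Hl HM.
  destruct (exists_min l) as [j [Hj Hmin]]; [intros ->; simpl in HM; lia|].
  apply NNPP; intros no.
  assert (length l <= length (seq j M))%nat as E; [|rewrite length_seq in E; lia].
  apply NoDup_incl_length; auto.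
  intros k Hk; apply in_seq; specialize (Hmin k Hk).
  destruct (le_lt_dec (j + M) k); [|lia].
  exfalso; apply no; exists j, k; auto.
Qed.

(** Cut the times into [q] blocks of length [h]. A block with more than [M] elements of [J] yields
    one pair with gap at least [M], at the cost of at most [h] elements; any other block loses at
    most [M]. *)
Lemma block_pairs (M h : nat) (q : nat) (J : list nat) :
  (0 < h)%nat -> NoDup J -> (forall j, In j J -> (j < q * h)%nat) ->
  exists T : list (nat * nat),
    NoDup (map (fun t => (fst t / h)%nat) T) /\
    (forall j k, In (j, k) T -> In j J /\ In k J /\ (j + M <= k)%nat /\
       (k / h = j / h)%nat) /\
    (length J <= M * q + h * length T)%nat.
Proof.
  intros Hh; revert J; induction q as [|q IH]; intros J HJ Hq.
  - exists []; repeat split; simpl; try tauto; [constructor|].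
    destruct J as [|j J]; simpl; [lia|]. specialize (Hq j); simpl in Hq; lia.
  - set (top := sel (fun j => (q * h <= j)%nat) J).
    destruct (IH (sel (fun j => ~ (q * h <= j)%nat) J)) as [T [T1 [T2 T3]]].
    { apply sel_NoDup; auto. }
    { intros j Hj; apply in_sel in Hj; lia. }
    generalize (sel_length_split (fun j => (q * h <= j)%nat) J); fold top; intros E.
    assert (forall j, In j top -> (j / h = q)%nat) as Htop.
    { intros j Hj; apply in_sel in Hj; destruct Hj as [Hj Hj'].
      specialize (Hq j Hj); symmetry; apply Nat.div_unique with (j - q * h)%nat; lia. }
    assert (forall j k, In (j, k) T -> In j J /\ In k J /\ (j + M <= k)%nat /\
       (k / h = j / h)%nat) as T2'.
    { intros j k Hjk; destruct (T2 j k Hjk) as [Hj [Hk ?]].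
      apply in_sel in Hj; apply in_sel in Hk; tauto. }
    destruct (le_lt_dec (length top) M) as [le|gt].
    + exists T; split; [|split]; auto; lia.
    + destruct (exists_spread_pair M top) as [j [k [Hj [Hk Hjk]]]]; auto.
      { apply sel_NoDup; auto. }
      exists ((j, k) :: T); split; [|split].
      * simpl; constructor; auto; rewrite Htop by auto.
        intros K; apply in_map_iff in K; destruct K as [[j' k'] [K K']]; simpl in K.
        destruct (T2 _ _ K') as [K'' _]; apply in_sel in K''; destruct K'' as [_ K''].
        apply K''; rewrite <- K, Nat.mul_comm; apply Nat.Div0.mul_div_le.
      * intros j' k' [K|K]; auto. injection K as <- <-.
        rewrite !Htop by auto; apply in_sel in Hj; apply in_sel in Hk; tauto.
      * assert (length top <= length (seq (q * h) h))%nat as F.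
        { apply NoDup_incl_length; [apply sel_NoDup; auto|].
          intros i Hi; apply in_sel in Hi; destruct Hi as [Hi Hi'].
          specialize (Hq i Hi); apply in_seq; lia. }
        rewrite length_seq in F; simpl length; lia.
Qed.

Section Independence.
Context {X : Type} (f : X -> X).

(** The density bound is asked for arbitrarily large [n] only, which is the form preserved by the
    pigeonhole principle [frequent_choice]. *)
Definition independent (A B : X -> Prop) : Prop :=
  exists c, 0 < c /\ forall N, exists n, (N <= n)%nat /\
    exists J, NoDup J /\ (forall j, In j J -> (j < n)%nat) /\
      c * INR n <= INR (length J) /\ shatters f J A B.

Lemma independent_nonempty (A B : X -> Prop) : independent A B -> exists x, A x.
Proof.
  intros [c [Hc H]]; destruct (H 1%nat) as [n [Hn [J [_ [_ [HJ S]]]]]].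
  assert (1 <= INR n) by (apply (le_INR 1); auto).
  destruct J as [|j J]; [simpl in HJ; nra|].
  destruct (S (fun _ => true)) as [x Hx].
  exists (Nat.iter j f x); apply (Hx j); simpl; auto.
Qed.

Lemma shatters_swap (J : list nat) (A B : X -> Prop) :
  shatters f J A B -> shatters f J B A.
Proof.
  intros H s; destruct (H (fun j => negb (s j))) as [x Hx]; exists x.
  intros j Hj; specialize (Hx j Hj); destruct (s j); auto.
Qed.

(** One point is kept for each pattern on [J], which produces the exponentially large family needed
    by [large_shattered_subset]. The predicate [Q] carries the sides already prescribed at earlier
    elements of [J] through the induction. *)
Lemma shattered_points (A B : X -> Prop) (J : list nat) (Q : X -> Prop) :
  (forall x, A x -> ~ B x) -> NoDup J ->
  (forall s : nat -> bool, exists x, Q x /\ forall j, In j J ->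
     if s j then A (Nat.iter j f x) else B (Nat.iter j f x)) ->
  exists S, NoDup S /\ length S = (2 ^ length J)%nat /\
    (forall x, In x S -> Q x /\
       forall j, In j J -> A (Nat.iter j f x) \/ B (Nat.iter j f x)) /\
    (forall x y, In x S -> In y S -> x <> y -> exists j, In j J /\
       ((A (Nat.iter j f x) /\ B (Nat.iter j f y)) \/
        (B (Nat.iter j f x) /\ A (Nat.iter j f y)))).
Proof.
  intros disj HJ; revert Q; induction HJ as [|j J Hj HJ IH]; intros Q H.
  - destruct (H (fun _ => true)) as [x [Hx _]]; exists [x]; repeat split.
    + repeat constructor; simpl; tauto.
    + destruct H0 as [<-|[]]; auto.
    + intros j [].
    + intros y z [<-|[]] [<-|[]]; congruence.
  - assert (forall b : bool, exists S, NoDup S /\ length S = (2 ^ length J)%nat /\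
      (forall x, In x S ->
        (Q x /\ if b then A (Nat.iter j f x) else B (Nat.iter j f x)) /\
        forall i, In i J -> A (Nat.iter i f x) \/ B (Nat.iter i f x)) /\
      (forall x y, In x S -> In y S -> x <> y -> exists i, In i J /\
         ((A (Nat.iter i f x) /\ B (Nat.iter i f y)) \/
          (B (Nat.iter i f x) /\ A (Nat.iter i f y))))) as half.
    { intros b; apply IH; intros s.
      destruct (H (fun i => if Nat.eqb i j then b else s i)) as [x [Qx Hx]].
      exists x; repeat split; auto.
      - specialize (Hx j); rewrite Nat.eqb_refl in Hx; apply Hx; simpl; auto.
      - intros k Hk; specialize (Hx k).
        destruct (Nat.eq_dec k j) as [e|ne]; [congruence|].
        rewrite (proj2 (Nat.eqb_neq k j) ne) in Hx; apply Hx; simpl; auto. }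
    destruct (half true) as [SA [A1 [A2 [A3 A4]]]].
    destruct (half false) as [SB [B1 [B2 [B3 B4]]]].
    exists (SA ++ SB); split; [|split; [|split]].
    + apply NoDup_app; auto; intros x HA HB.
      apply (disj (Nat.iter j f x)); [apply A3 | apply B3]; auto.
    + rewrite length_app, A2, B2; simpl; lia.
    + intros x Hx; apply in_app_or in Hx; destruct Hx as [Hx|Hx];
        [destruct (A3 x Hx) as [[K1 K2] K3] | destruct (B3 x Hx) as [[K1 K2] K3]];
        (split; [exact K1 | intros i [<-|Hi]; auto]).
    + intros x y Hx Hy Hxy; apply in_app_or in Hx; apply in_app_or in Hy.
      destruct Hx as [Hx|Hx]; destruct Hy as [Hy|Hy].
      * destruct (A4 x y Hx Hy Hxy) as [i [Hi K]]; exists i; simpl; auto.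
      * exists j; split; [simpl; auto|]; left; split; [apply A3 | apply B3]; auto.
      * exists j; split; [simpl; auto|]; right; split; [apply B3 | apply A3]; auto.
      * destruct (B4 x y Hx Hy Hxy) as [i [Hi K]]; exists i; simpl; auto.
Qed.

(** Label a visit to [A] by a piece containing it and a visit to [B] by [B] itself. The points
    realizing all patterns are separated by these labels, so [large_shattered_subset] applies at
    rate [ln 2] and returns a pair made of one piece and [B]. *)
Lemma independent_split (A B : X -> Prop) (Cs : list (X -> Prop)) :
  (forall x, A x -> ~ B x) ->
  (forall x, A x -> exists U, In U Cs /\ U x) ->
  (forall U x, In U Cs -> U x -> A x) ->
  independent A B -> exists U, In U Cs /\ independent U B.
Proof.
  intros disj Hcov Hsub [c [Hc H]].
  (* Here being far is a relation between labels, not a distance: exactly one of the two is [B]. *)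
  set (far := fun U V : X -> Prop => (U = B /\ V <> B) \/ (U <> B /\ V = B)).
  destruct (large_shattered_subset f (B :: Cs) far (ln 2)) as [eta [He comb]].
  { rewrite <- ln_1; apply ln_increasing; lra. }
  { unfold far; tauto. }
  destruct (frequent_choice Cs (fun n U => exists J, NoDup J /\
    (forall j, In j J -> (j < n)%nat) /\ eta * c * INR n <= INR (length J) /\
    shatters f J U B)) as [U [HU HQ]].
  - intros N; destruct (H (S N)) as [n [Hn [J [J1 [J2 [J3 J4]]]]]].
    assert (1 <= INR n) by (apply (le_INR 1); lia).
    destruct (shattered_points A B J (fun _ => True) disj J1) as [S [S1 [S2 [S3 S4]]]].
    { intros s; destruct (J4 s) as [x Hx]; exists x; auto. }
    destruct (comb J S) as [U [V [J' [HU [HV [HUV [J1' [J2' [J3' J4']]]]]]]]]; auto.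
    + intros ->; simpl in J3; nra.
    + rewrite S2, pow_INR, <- Rpower_pow by (simpl; lra).
      unfold Rpower; rewrite Rmult_comm; replace (INR 2) with 2 by (simpl; lra); lra.
    + intros x z Hx Hz; destruct (S3 x Hx) as [_ K]; destruct (K z Hz) as [K'|K'].
      * destruct (Hcov _ K') as [U [? ?]]; exists U; simpl; auto.
      * exists B; simpl; auto.
    (* By disjointness of [A] and [B], any label of a point reveals the side it lies on, so points
       on opposite sides get far labels. *)
    + assert (forall U x, In U (B :: Cs) -> U x -> A x -> U <> B) as inA.
      { intros U x HU Ux Ax ->; apply (disj x); auto. }
      assert (forall U x, In U (B :: Cs) -> U x -> B x -> U = B) as inB.
      { intros U x [<-|HU] Ux Bx; auto; exfalso; apply (disj x); eauto. }
      intros x y Hx Hy Hxy; destruct (S4 x y Hx Hy Hxy) as [j [Hj K]].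
      exists j; split; auto; intros U V HU HV Ux Vy; unfold far.
      destruct K as [[K1 K2]|[K1 K2]]; [right|left]; split; eauto.
    + assert (eta * c * INR n <= INR (length J')).
      { eapply Rle_trans; [|exact J3']; rewrite Rmult_assoc.
        apply Rmult_le_compat_l; lra. }
      destruct HUV as [[-> nV]|[nU ->]]; [exists n, V | exists n, U].
      * split; [lia|]; split; [simpl in HV; intuition congruence|].
        exists J'; repeat split; auto; apply shatters_swap; auto.
      * split; [lia|]; split; [simpl in HU; intuition congruence|].
        exists J'; repeat split; auto.
  - exists U; split; auto; exists (eta * c); split; auto; nra.
Qed.

(** Pair up times of [J] inside blocks and keep the pairs with the most frequent gap [m]. Their
    first entries form the new set of times, and the visits at the second entries can be prescribed
    separately, all in [A] or all in [B]. *)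
Lemma independent_return (A B : X -> Prop) (M : nat) :
  independent A B -> exists m, (M <= m)%nat /\
    independent (fun x => A x /\ A (Nat.iter m f x)) B /\
    independent (fun x => A x /\ B (Nat.iter m f x)) B.
Proof.
  intros [c [Hc H]].
  (* The successor forces a positive gap, so that the two times of a pair differ. *)
  set (M' := S M).
  assert (1 <= INR M') by (apply (le_INR 1); unfold M'; lia).
  (* With this block length the unpaired times, at most [M' * (n / h + 1)], amount to at most half
     of [c * INR n]. *)
  destruct (INR_unbounded (4 * INR M' / c)) as [h Hh].
  apply Rlt_div_l in Hh; [|lra].
  assert (0 < INR h) as hpos by nra.
  assert (0 < h)%nat by (apply INR_lt; simpl; lra).
  (* One factor [h] is lost in passing from times to pairs, the other in fixing one of the [h]
     possible gaps. *)
  set (c' := c / (2 * INR h * INR h)).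
  assert (0 < c') by (apply Rdiv_lt_0_compat; nra).
  destruct (frequent_choice (seq 0 h) (fun n m => (M <= m)%nat /\
    exists J, NoDup J /\ (forall j, In j J -> (j < n)%nat) /\
      c' * INR n <= INR (length J) /\
      shatters f J (fun x => A x /\ A (Nat.iter m f x)) B /\
      shatters f J (fun x => A x /\ B (Nat.iter m f x)) B)) as [m [Hm HQ]].
  - intros N; destruct (H (h + N)%nat) as [n [Hn [J [J1 [J2 [J3 J4]]]]]].
    assert (INR h <= INR n) by (apply le_INR; lia).
    destruct (block_pairs M' h (n / h + 1) J) as [T [T1 [T2 T3]]]; auto.
    { intros j Hj; specialize (J2 j Hj).
      generalize (Nat.div_mod_eq n h) (Nat.mod_upper_bound n h); nia. }
    assert (c * INR n <= 2 * INR h * INR (length T)) as TL.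
    { apply le_INR in T3; rewrite plus_INR, !mult_INR, plus_INR in T3; simpl (INR 1) in T3.
      assert (INR h * INR (n / h) <= INR n).
      { rewrite <- mult_INR; apply le_INR; apply Nat.Div0.mul_div_le. }
      assert (0 <= INR (n / h)) by apply pos_INR.
      assert (4 * (INR M' * INR (n / h)) <= c * INR n) by nra.
      assert (4 * INR M' <= c * INR n) by nra.
      lra. }
    assert (exists m, In m (seq 0 h) /\ INR (length T) <=
      INR h * INR (length (sel (fun t => snd t = fst t + m)%nat T))) as [m [Hm HT]].
    { apply NNPP; intros no.
      assert (0 < INR (length T)) by nra.
      assert (INR (length (sel (fun t => exists m, In m (seq 0 h) /\
        snd t = fst t + m)%nat T)) <= INR h * ((INR (length T) - 1) / INR h)) as K.
      { rewrite <- (length_seq h 0) at 1.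
        apply (sel_union_bound (fun m t => snd t = fst t + m)%nat); intros m Hm.
        apply Rle_div_r; auto.
        set (k := length (sel (fun t => snd t = fst t + m)%nat T)).
        (* Strictness between integers gains the unit that makes the union bound fall short of
           [length T]. *)
        assert (S (k * h) <= length T)%nat as E.
        { apply INR_lt; rewrite mult_INR, Rmult_comm; apply Rnot_le_lt; intros ?.
          apply no; exists m; auto. }
        apply le_INR in E; rewrite S_INR, mult_INR in E; lra. }
      replace (INR h * ((INR (length T) - 1) / INR h)) with (INR (length T) - 1) in K
        by (field; lra).
      assert (length T <= length (sel (fun t => exists m, In m (seq 0 h) /\
        snd t = fst t + m)%nat T))%nat as E; [|apply le_INR in E; lra].
      apply NoDup_incl_length; [eapply NoDup_map_inv; eauto|].
      intros [j k] Hjk; apply in_sel; split; auto; simpl.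
      destruct (T2 j k Hjk) as [? [? [? Hb]]]; exists (k - j)%nat; split; [|lia].
      apply in_seq; generalize (Nat.div_mod_eq k h) (Nat.div_mod_eq j h)
        (Nat.mod_upper_bound k h); rewrite Hb; lia. }
    set (T' := sel (fun t => snd t = fst t + m)%nat T) in HT.
    assert (forall j, In j (map fst T') -> In (j, j + m)%nat T) as HT'.
    { intros j Hj; apply in_map_iff in Hj; destruct Hj as [[a b] [<- Hj]].
      apply in_sel in Hj; simpl in *; destruct Hj as [Hj <-]; auto. }
    assert (exists j, In j (map fst T')) as [j0 Hj0].
    { destruct T' as [|t T']; [simpl in HT; nra|]; exists (fst t); simpl; auto. }
    assert (M' <= m)%nat as Mm by (destruct (T2 _ _ (HT' _ Hj0)); lia).
    assert (forall a b, In a T -> In b T -> (fst a / h = fst b / h)%nat -> a = b) as inj.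
    { intros a b Ha Hb E; apply (NoDup_map_injective _ T a b T1); auto. }
    exists n, m; split; [lia|]; split; auto; split; [unfold M' in Mm; lia|].
    exists (map fst T').
    assert (forall (e s : nat -> bool), exists x, forall j, In j (map fst T') ->
      (if s j then A (Nat.iter j f x) else B (Nat.iter j f x)) /\
      (if e (j + m)%nat then A (Nat.iter (j + m) f x) else B (Nat.iter (j + m) f x)))
      as real.
    { intros e s.
      destruct (J4 (fun i => if asb (In i (map fst T')) then s i else e i)) as [x Hx].
      exists x; intros j Hj; destruct (T2 _ _ (HT' j Hj)) as [K1 [K2 [K3 K4]]]; split.
      - specialize (Hx j K1); simpl in Hx.
        replace (asb (In j (map fst T'))) with true in Hx; auto.
        symmetry; apply asb_true; auto.
      - specialize (Hx (j + m)%nat K2); simpl in Hx.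
        (* A second entry is never a first entry: it would start a pair in the block of [j], and
           there is only one pair per block. Hence [s] and [e] do not conflict. *)
        replace (asb (In (j + m)%nat (map fst T'))) with false in Hx; auto.
        symmetry; apply asb_false; intros K.
        assert ((j, j + m) = (j + m, j + m + m))%nat as E by (apply inj; auto).
        injection E; lia. }
    repeat split.
    + apply NoDup_map_inv with (f := fun j => (j / h)%nat); rewrite map_map.
      unfold T'; clear - T1; unfold sel; induction T as [|t T IH]; simpl; auto.
      simpl in T1; inversion T1; subst.
      destruct (asb _); simpl; auto; constructor; auto.
      intros K; apply H1; apply in_map_iff in K; destruct K as [a [<- K]].
      apply filter_In in K; apply in_map_iff; exists a; tauto.
    + intros j Hj; apply J2; apply (T2 j (j + m)%nat); auto.
    + rewrite length_map; unfold c'.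
      apply Rmult_le_reg_l with (2 * INR h * INR h); [nra|].
      replace (2 * INR h * INR h * (c / (2 * INR h * INR h) * INR n))
        with (c * INR n) by (field; lra).
      nra.
    + intros s; destruct (real (fun _ => true) s) as [x Hx]; exists x; intros j Hj.
      destruct (Hx j Hj) as [K1 K2]; rewrite Nat.add_comm, Nat.iter_add in K2.
      destruct (s j); auto.
    + intros s; destruct (real (fun _ => false) s) as [x Hx]; exists x; intros j Hj.
      destruct (Hx j Hj) as [K1 K2]; rewrite Nat.add_comm, Nat.iter_add in K2.
      destruct (s j); auto.
  - assert (M <= m)%nat as Mm by (destruct (HQ O) as [n [_ [? _]]]; auto).
    exists m; split; [auto|]; split; exists c'; split; auto; intros N;
      destruct (HQ N) as [n [Hn [_ [J [K1 [K2 [K3 [K4 K5]]]]]]]];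
      exists n; split; auto; exists J; auto.
Qed.

End Independence.

(** * Recurrent points and entropy *)

Section Dynamics.
Context {X : Type} (d : X -> X -> R) (f : X -> X).
Context (d_metric : is_metric d).
Context (X_compact : metric_compact d).
Context (f_continuous : metric_continuous d f).

(** * Metric and compactness preliminaries *)

Lemma dist_refl (x : X) : d x x = 0.
Proof. apply (proj1 (proj2 d_metric)); auto. Qed.

Lemma dist_sym (x y : X) : d x y = d y x.
Proof. apply d_metric. Qed.

Lemma dist_triangle (x y z : X) : d x z <= d x y + d y z.
Proof. apply d_metric. Qed.

Lemma finite_cover_by_balls (r : R) :
  0 < r -> exists cs, forall x, exists c, In c cs /\ d c x < r.
Proof.
  intros Hr; apply (X_compact X (fun c x => d c x < r)).
  - intros c x Hx; exists (r - d c x); split; [lra|]; intros y Hy.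
    generalize (dist_triangle c x y); lra.
  - intros x; exists x; rewrite dist_refl; auto.
Qed.

Definition metric_closed (A : X -> Prop) : Prop := metric_open d (fun x => ~ A x).

Lemma closed_inter (A B : X -> Prop) :
  metric_closed A -> metric_closed B -> metric_closed (fun x => A x /\ B x).
Proof.
  intros HA HB x Hx; apply not_and_or in Hx; destruct Hx as [Hx|Hx];
    [destruct (HA x Hx) as [r [Hr K]] | destruct (HB x Hx) as [r [Hr K]]];
    exists r; split; auto; intros y Hy [? ?]; apply (K y Hy); auto.
Qed.

Lemma closed_ball (c : X) (r : R) : metric_closed (fun x => d c x <= r).
Proof.
  intros x Hx; exists (d c x - r); split; [lra|]; intros y Hy K.
  generalize (dist_triangle c y x); rewrite (dist_sym y x); lra.
Qed.

Lemma continuous_iter (n : nat) : metric_continuous d (Nat.iter n f).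
Proof.
  induction n as [|n IH]; intros x eps He.
  - exists eps; auto.
  - destruct (f_continuous (Nat.iter n f x) eps He) as [r [Hr K]].
    destruct (IH x r Hr) as [r' [Hr' K']]; exists r'; split; auto.
    intros y Hy; apply K, K'; auto.
Qed.

Lemma closed_preimage_iter (A : X -> Prop) (n : nat) :
  metric_closed A -> metric_closed (fun x => A (Nat.iter n f x)).
Proof.
  intros HA x Hx; destruct (HA _ Hx) as [r [Hr K]].
  destruct (continuous_iter n x r Hr) as [r' [Hr' K']].
  exists r'; split; auto.
Qed.

Lemma nested_intersection (C : nat -> X -> Prop) :
  (forall n, metric_closed (C n)) -> (forall n, exists x, C n x) ->
  (forall n x, C (S n) x -> C n x) -> exists x, forall n, C n x.
Proof.
  intros Hcl Hne Hdec.
  assert (forall n m x, (n <= m)%nat -> C m x -> C n x) as Hle.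
  { intros n m x Hnm; induction Hnm; auto. }
  apply NNPP; intros no.
  destruct (X_compact nat (fun n x => ~ C n x)) as [l Hl]; auto.
  { intros x; apply not_all_ex_not; intros K; apply no; eauto. }
  assert (exists m, forall n, In n l -> (n <= m)%nat) as [m Hm].
  { exists (list_max l); apply Forall_forall, list_max_le; auto. }
  destruct (Hne m) as [x Hx]; destruct (Hl x) as [n [Hn K]].
  apply K, (Hle n m); auto.
Qed.

(** Closed balls of radius [eps / 8] serve as letters. Orbit points more than [eps] apart lie only
    in balls that are more than [eps / 2] apart, so separation of orbits becomes separation by far
    letters. *)
Lemma separated_independent_pair (eps c : R) :
  0 < eps -> 0 < c ->
  (forall N, exists n E, (N <= n)%nat /\ separated_set d f n eps E /\
     exp (c * INR n) <= INR (length E)) ->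
  exists A B, metric_closed A /\ metric_closed B /\ independent f A B /\
    forall x y, A x -> B y -> eps / 4 < d x y.
Proof.
  intros He Hc H.
  destruct (finite_cover_by_balls (eps / 8)) as [cs Hcs]; [lra|].
  set (L := map (fun c x => d c x <= eps / 8) cs).
  set (far := fun A B : X -> Prop => forall x y, A x -> B y -> eps / 4 < d x y).
  destruct (large_shattered_subset f L far c Hc) as [eta [Heta comb]].
  { intros U HU K; apply in_map_iff in HU; destruct HU as [a [<- _]].
    assert (eps / 4 < d a a) as K' by (apply K; rewrite dist_refl; lra).
    rewrite dist_refl in K'; lra. }
  destruct (frequent_choice (list_prod L L) (fun n p => far (fst p) (snd p) /\
    exists J, NoDup J /\ (forall j, In j J -> (j < n)%nat) /\
      eta * INR n <= INR (length J) /\ shatters f J (fst p) (snd p)))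
    as [[A B] [HAB K]].
  - intros N; destruct (H (S N)) as [n [E [Hn [[E1 E2] E3]]]].
    destruct (comb (seq 0 n) E) as [U [V [J [HU [HV [HUV [J1 [J2 [J3 J4]]]]]]]]].
    + apply seq_NoDup.
    + destruct n; [lia | discriminate].
    + auto.
    + rewrite length_seq; auto.
    + intros x z _ _; destruct (Hcs (Nat.iter z f x)) as [a [Ha Hax]].
      exists (fun x => d a x <= eps / 8); split; [|apply Rlt_le, Hax].
      apply in_map_iff; exists a; auto.
    + intros x y Hx Hy Hxy; destruct (E2 x y Hx Hy Hxy) as [k [Hk Hsep]].
      exists k; split; [apply in_seq; lia|]; intros U V HU HV.
      apply in_map_iff in HU; destruct HU as [a [<- _]].
      apply in_map_iff in HV; destruct HV as [b [<- _]].
      intros Hax Hby x' y' Hax' Hby'; cbv beta in *.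
      set (u := Nat.iter k f x) in *; set (v := Nat.iter k f y) in *.
      generalize (dist_triangle u x' v) (dist_triangle x' y' v) (dist_triangle u a x')
        (dist_triangle y' b v) (dist_sym u a) (dist_sym y' b); lra.
    + exists n, (U, V); split; [lia|]; split; [apply in_prod; auto|].
      split; auto; exists J; rewrite length_seq in J3; repeat split; auto.
      intros j Hj; specialize (J2 j Hj); apply in_seq in J2; lia.
  - apply in_prod_iff in HAB; destruct HAB as [HA HB].
    assert (forall U, In U L -> metric_closed U) as Hcl.
    { intros U HU; apply in_map_iff in HU; destruct HU as [a [<- _]].
      apply closed_ball. }
    exists A, B; repeat split; auto.
    + exists eta; split; auto; intros N; destruct (K N) as [n [Hn [_ HJ]]]; eauto.
    + destruct (K O) as [n [_ [Hfar _]]]; exact Hfar.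
Qed.

(** * Recurrent points outside countably many sets *)

Section RecurrentPoint.
Context (A B : X -> Prop) (eps : R).
Context (B_closed : metric_closed B).
Context (AB_far : forall x y, A x -> B y -> eps < d x y).
Context (eps_pos : 0 < eps).

Definition good (C : X -> Prop) : Prop :=
  metric_closed C /\ (forall x, C x -> A x) /\ independent f C B.

(** If some point of [P] in [C] returns to [C], inside [A], at time [m], then no point of [P] can be
    in [B] at that time, and [C /\ f^-m B] avoids [P]. Otherwise [C /\ f^-m C] already does. *)
Lemma good_avoid (C P : X -> Prop) (N : nat) :
  (forall x y n, P x -> P y -> (N <= n)%nat ->
     d (Nat.iter n f x) (Nat.iter n f y) <= eps) ->
  good C -> exists C', good C' /\ (forall x, C' x -> C x) /\ (forall x, C' x -> ~ P x).
Proof.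
  intros HP [C1 [C2 C3]].
  destruct (independent_return f C B N C3) as [m [Hm [IA IB]]].
  destruct (classic (exists x, P x /\ C x /\ C (Nat.iter m f x))) as [[x [Px [_ Cx]]]|no].
  - exists (fun y => C y /\ B (Nat.iter m f y)); repeat split; auto; try tauto.
    + apply closed_inter; auto; apply closed_preimage_iter; auto.
    + intros y [Cy _]; auto.
    + intros y [_ By] Py; specialize (HP x y m Px Py Hm).
      specialize (AB_far _ _ (C2 _ Cx) By); lra.
  - exists (fun y => C y /\ C (Nat.iter m f y)); repeat split; auto; try tauto.
    + apply closed_inter; auto; apply closed_preimage_iter; auto.
    + intros y [Cy _]; auto.
    + intros y [Cy Cy'] Py; apply no; exists y; auto.
Qed.

(** One piece of [C] of diameter at most [2 * r / 3] remains independent of [B]; points that start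
    in it and come back to it move by less than [r]. *)
Lemma good_return (C : X -> Prop) (k : nat) (r : R) :
  0 < r -> good C ->
  exists C', good C' /\ (forall x, C' x -> C x) /\
    exists m, (k <= m)%nat /\ forall x, C' x -> d (Nat.iter m f x) x < r.
Proof.
  intros Hr [C1 [C2 C3]].
  destruct (finite_cover_by_balls (r / 3)) as [cs Hcs]; [lra|].
  destruct (independent_split f C B (map (fun c x => C x /\ d c x <= r / 3) cs))
    as [U [HU HUB]]; auto.
  - intros x Cx Bx; specialize (AB_far x x (C2 x Cx) Bx).
    rewrite dist_refl in AB_far; lra.
  - intros x Cx; destruct (Hcs x) as [c [Hc Hx]].
    exists (fun x => C x /\ d c x <= r / 3); split; [|split; auto; lra].
    apply in_map_iff; exists c; auto.
  - intros U x HU Ux; apply in_map_iff in HU; destruct HU as [c [<- _]]; tauto.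
  - apply in_map_iff in HU; destruct HU as [c [<- _]].
    destruct (independent_return f _ B k HUB) as [m [Hm [IA _]]].
    eexists; split; [split; [|split; [|exact IA]]|split]; simpl.
    + assert (metric_closed (fun x => C x /\ d c x <= r / 3)) as K.
      { apply closed_inter; auto; apply closed_ball. }
      apply closed_inter; auto; apply (closed_preimage_iter _ m K).
    + intros x [[Cx _] _]; auto.
    + tauto.
    + exists m; split; auto; intros x [[_ H1] [_ H2]].
      generalize (dist_triangle (Nat.iter m f x) c x)
        (dist_sym c (Nat.iter m f x)); lra.
Qed.

Lemma recurrent_point_avoiding (P : nat -> X -> Prop) :
  metric_closed A -> independent f A B ->
  (forall k, exists N, forall x y n, P k x -> P k y -> (N <= n)%nat ->
     d (Nat.iter n f x) (Nat.iter n f y) <= eps) ->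
  exists x, recurrent_set d f x /\ forall k, ~ P k x.
Proof.
  intros A_closed AB_ind HP.
  (* Stage [k] first leaves [P k], then adds a return after time at least [k] within [/ INR (S k)].
     The sigma type lets the stages be iterated by recursion; a point of their intersection inherits
     all these properties. *)
  assert (forall (k : nat) (C : {C | good C}), {C' : {C | good C} |
    (forall x, proj1_sig C' x -> proj1_sig C x) /\
    (forall x, proj1_sig C' x -> ~ P k x) /\
    exists m, (k <= m)%nat /\
      forall x, proj1_sig C' x -> d (Nat.iter m f x) x < / INR (S k)}) as step.
  { intros k [C HC]; apply constructive_indefinite_description.
    destruct (HP k) as [N HN].
    destruct (good_avoid C (P k) N HN HC) as [C1 [G1 [S1 D1]]].
    destruct (good_return C1 k (/ INR (S k))) as [C2 [G2 [S2 D2]]]; auto.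
    { apply Rinv_0_lt_compat, lt_0_INR; lia. }
    exists (exist _ C2 G2); simpl; split; [|split]; auto. }
  assert (good A) as GA by (repeat split; auto).
  set (C := fix C k := match k with O => exist _ A GA | S k => proj1_sig (step k (C k)) end).
  destruct (nested_intersection (fun k => proj1_sig (C k))) as [x Hx].
  - intros k; apply (proj2_sig (C k)).
  - intros k; eapply independent_nonempty; apply (proj2_sig (C k)).
  - intros k; apply (proj2_sig (step k (C k))).
  - exists x; split.
    + assert (forall k, exists m, (k <= m)%nat /\ d (Nat.iter m f x) x < / INR (S k))
        as ret.
      { intros k; destruct (proj2_sig (step k (C k))) as [_ [_ [m [Hm K]]]].
        exists m; split; auto; apply K, (Hx (S k)). }
      destruct (choice _ ret) as [nk Hnk]; exists nk; split.
      * intros M; exists M; intros k Hk; destruct (Hnk k); lia.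
      * intros e He; destruct (archimed_cor1 e He) as [K [HK HK0]].
        exists K; intros k Hk; eapply Rlt_trans; [apply Hnk|].
        eapply Rle_lt_trans; [|apply HK]; apply Rinv_le_contravar.
        -- apply lt_0_INR; auto.
        -- apply le_INR; lia.
    + intros k; destruct (proj2_sig (step k (C k))) as [_ [K _]].
      apply K, (Hx (S k)).
Qed.

End RecurrentPoint.

(** * Entropy from counts of separated sets *)

Lemma entropy_zero_of_subexponential :
  (forall eps c, 0 < eps -> 0 < c -> exists N, forall n E, (N <= n)%nat ->
     separated_set d f n eps E -> INR (length E) < exp (c * INR n)) ->
  topological_entropy d f = Finite 0.
Proof.
  intros H.
  assert (forall eps N, Rbar_le 0 (tail_sup d f eps N)) as tail_nonneg.
  { intros eps N; unfold tail_sup.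
    destruct (Lub_Rbar_correct (fun r => exists n (E : list X), (N <= n)%nat /\
      (0 < n)%nat /\ separated_set d f n eps E /\
      r = ln (INR (Nat.max 1 (length E))) / INR n)) as [ub _].
    (* The empty set is separated and contributes [ln 1 = 0]; [S N] is a positive time beyond
       [N]. *)
    apply ub; exists (S N), []; repeat split; try lia; [constructor | intros ? ? []|].
    simpl (INR _); rewrite ln_1; unfold Rdiv; ring. }
  assert (forall eps, 0 < eps -> entropy_eps d f eps = Finite 0) as ent_zero.
  { intros eps He; apply Rbar_is_glb_unique; split; [intros y [N ->]; auto|].
    intros b Hb.
    assert (forall c, 0 < c -> Rbar_le b c) as small.
    { intros c Hc; destruct (H eps c He Hc) as [N HN].
      apply Rbar_le_trans with (tail_sup d f eps N); [apply Hb; eauto|].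
      apply (proj2 (Lub_Rbar_correct _)).
      intros r [n [E [Hn [Hn0 [HE ->]]]]].
      change (ln (INR (Nat.max 1 (length E))) / INR n <= c).
      assert (0 < INR n) by (apply lt_0_INR; auto).
      apply Rle_div_l; auto.
      rewrite <- (ln_exp (c * INR n)); apply ln_le; [apply lt_0_INR; lia|].
      destruct (Nat.max_spec 1 (length E)) as [[_ ->]|[_ ->]].
      - apply Rlt_le; eauto.
      - simpl; rewrite <- exp_0; apply Rlt_le, exp_increasing; nra. }
    destruct b as [r| |]; simpl in *; auto.
    - apply Rnot_lt_le; intros Hr; specialize (small (r / 2)); lra.
    - apply (small 1); lra. }
  apply Rbar_is_lub_unique; split.
  - intros y [eps [He ->]]; rewrite ent_zero by auto; apply Rbar_le_refl.
  - intros b Hb; rewrite <- (ent_zero 1) by lra; apply Hb; exists 1; split; [lra | auto].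
Qed.

Lemma entropy_zero_of_countable_cover :
  (forall eps, 0 < eps -> exists P : nat -> X -> Prop,
     (forall k, exists N, forall x y n, P k x -> P k y -> (N <= n)%nat ->
        d (Nat.iter n f x) (Nat.iter n f y) <= eps) /\
     forall x, recurrent_set d f x -> exists k, P k x) ->
  topological_entropy d f = Finite 0.
Proof.
  intros cover; apply entropy_zero_of_subexponential; intros eps c He Hc.
  apply NNPP; intros no.
  destruct (separated_independent_pair eps c He Hc) as [A [B [HA [HB [HAB Hfar]]]]].
  { intros N; apply NNPP; intros K; apply no; exists N; intros n E Hn HE.
    apply Rnot_le_lt; intros L; apply K; exists n, E; auto. }
  (* The scale of the cover is the distance guaranteed between [A] and [B]. *)
  destruct (cover (eps / 4)) as [P [HP HR]]; [lra|].
  destruct (recurrent_point_avoiding A B (eps / 4) HB Hfar) with (P := P)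
    as [x [Rx Px]]; auto; [lra|].
  destruct (HR x Rx) as [k Hk]; apply (Px k Hk).
Qed.

(** * Countable covers obtained from the two hypotheses *)

Lemma stable_classes_cover (eps : R) :
  countably_many_stable_classes d f -> 0 < eps ->
  exists P : nat -> X -> Prop,
    (forall k, exists N, forall x y n, P k x -> P k y -> (N <= n)%nat ->
       d (Nat.iter n f x) (Nat.iter n f y) <= eps) /\
    forall x, exists k, P k x.
Proof.
  intros [c Hc] He.
  (* A representative is fixed for each index; [None] handles the terms of the enumeration that are
     not stable classes. *)
  assert (forall k, exists o : option X, match o with
    | Some p => forall x, stable_class d f p x <-> c k x
    | None => ~ exists p, forall x, stable_class d f p x <-> c k x end) as rep.
  { intros k.
    destruct (classic (exists p, forall x, stable_class d f p x <-> c k x)) as [[p Hp]|no];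
      [exists (Some p) | exists None]; auto. }
  destruct (choice _ rep) as [o Ho].
  (* Closeness within a class is not uniform in time, so each class is divided according to a time
     [N] after which the orbit stays within [eps / 2] of that of the representative. *)
  exists (fun i => let (k, N) := of_nat i in fun x =>
    exists p, o k = Some p /\ forall n, (N <= n)%nat ->
      d (Nat.iter n f x) (Nat.iter n f p) < eps / 2).
  split.
  - intros i; destruct (of_nat i) as [k N]; exists N.
    intros x y n [p [Hp Hx]] [p' [Hp' Hy]] Hn.
    rewrite Hp in Hp'; injection Hp' as <-.
    specialize (Hx n Hn); specialize (Hy n Hn).
    generalize (dist_triangle (Nat.iter n f x) (Nat.iter n f p) (Nat.iter n f y))
      (dist_sym (Nat.iter n f p) (Nat.iter n f y)); lra.
  - intros x; destruct (Hc x) as [k Hk]; specialize (Ho k).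
    destruct (o k) as [p|] eqn:E; [|exfalso; apply Ho; exists x; auto].
    assert (stable_class d f p x) as K.
    { apply Ho, Hk; intros e H; exists O; intros; rewrite dist_refl; auto. }
    destruct (K (eps / 2)) as [N HN]; [lra|].
    exists (to_nat (k, N)); rewrite cancel_of_to; exists p; auto.
Qed.

(** Points are sorted by a radius of stability [/ INR (S j)] and by a ball of half that radius from
    a finite cover. Two points of one piece are then within the stability radius of each other, so
    their orbits stay close from time 0 on. *)
Lemma lyapunov_stable_cover (A : X -> Prop) (eps : R) :
  lyapunov_stable_on d f A -> 0 < eps ->
  exists P : nat -> X -> Prop,
    (forall k x y n, P k x -> P k y -> d (Nat.iter n f x) (Nat.iter n f y) <= eps) /\
    forall x, A x -> exists k, P k x.
Proof.
  intros Hst He.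
  assert (forall j, exists cs, forall x, exists c, In c cs /\ d c x < / INR (S j) / 2)
    as cov.
  { intros j; apply finite_cover_by_balls.
    assert (0 < / INR (S j)) by (apply Rinv_0_lt_compat, lt_0_INR; lia); lra. }
  destruct (choice _ cov) as [cs Hcs].
  exists (fun k => let (j, i) := of_nat k in fun x => A x /\
    (forall y, d x y < / INR (S j) -> A y ->
       forall n, d (Nat.iter n f x) (Nat.iter n f y) < eps) /\
    exists c, nth_error (cs j) i = Some c /\ d c x < / INR (S j) / 2).
  split.
  - intros k; destruct (of_nat k) as [j i].
    intros x y n [Ax [Hx [c [Hc Hcx]]]] [Ay [_ [c' [Hc' Hcy]]]].
    rewrite Hc in Hc'; injection Hc' as <-.
    apply Rlt_le, Hx; auto.
    generalize (dist_triangle x c y) (dist_sym x c); lra.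
  - intros x Ax; destruct (Hst x Ax eps He) as [r [Hr K]].
    destruct (archimed_cor1 r Hr) as [[|j] [Hj Hj0]]; [lia|].
    destruct (Hcs j x) as [c [Hc Hcx]].
    destruct (In_nth_error _ _ Hc) as [i Hi].
    exists (to_nat (j, i)); rewrite cancel_of_to; split; [auto|split].
    + intros y Hy; apply K; lra.
    + exists c; auto.
Qed.

End Dynamics.

Theorem theorem4p5 (X : Type) (d : X -> X -> R) (f : X -> X) :
  is_metric d -> metric_compact d -> metric_continuous d f ->
  (countably_many_stable_classes d f \/ lyapunov_stable_on d f (recurrent_set d f)) ->
  topological_entropy d f = Finite 0.
Proof.
  intros Hd Hc Hf H; apply entropy_zero_of_countable_cover; auto; intros eps He.
  destruct H as [H|H].
  - destruct (stable_classes_cover d f Hd eps H He) as [P [P1 P2]].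
    exists P; split; auto.
  - destruct (lyapunov_stable_cover d f Hd Hc _ eps H He) as [P [P1 P2]].
    exists P; split; auto; intros k; exists O; intros x y n Hx Hy _; eauto.
Qed.
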